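(* Consider either the finite mixture model or the orbit retrieval model (both described in the context), with parameter $\theta$ and ground truth parameter $\theta_*$. In both models, $$\nabla_{\theta'}Q(\theta'\mid\theta;\theta_* )\big|_{\theta'=\theta}=\nabla_\theta L(\theta;\theta_* ).$$ Therefore gradient EM with step size $\tau$, i.e. $\theta^{(t+1)}=\theta^{(t)}+\tau\nabla_{\theta'}Q(\theta'\mid\theta^{(t)};\theta_* )|_{\theta'=\theta^{(t)}}$, is the same as gradient ascent on $L(\cdot\,;\theta_* )$ with step size $\tau$. For the finite mixture model, the standard EM update $\theta^{(t+1)}=\arg\max_{\theta'}Q(\theta'\mid\theta^{(t)};\theta_* )$ can be written, for $\chi=1,\dots,K$, as $$\theta_\chi^{(t+1)}=\theta_\chi^{(t)}+\tau_\chi^t\,\nabla_{\theta_\chi}L(\theta^{(t)};\theta_* ),\qquad \tau_\chi^t=\frac{\sigma^2}{\alpha_\chi\,\mathbb E_Y[w_{\theta^{(t)}}(Y,\chi)]}.$$ For the (possibly infinite) orbit retrieval model, the standard EM update can be written as $$\theta^{(t+1)}=\theta^{(t)}+\sigma^2\,\nabla_\theta L(\theta^{(t)};\theta_* ).$$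
   Context: Let $g(x)=(2\pi)^{-d/2}e^{-\|x\|^2/2}$ on $\mathbb R^d$ and $\sigma>0$. Models have the form $Y=\sigma Z+\theta_{\boldsymbol\chi}$, where $Z\sim\mathcal N(0,I_d)$ is independent of the latent variable $\boldsymbol\chi\sim\rho$, and $\rho$ is a known probability measure on a set $X$. Finite mixture model: $X=\{1,\dots,K\}$, $\rho(\{j\})=\alpha_j>0$ with $\sum_j\alpha_j=1$; the parameter is $\theta=(\theta_\chi)_{\chi=1}^K$, with $\theta_\chi\in\mathbb R^d$. Orbit retrieval model: $G=\{g_\chi:\chi\in X\}\subset O(d)$ is a (possibly infinite) group of orthogonal matrices, $\rho$ is an arbitrary probability measure on $X$; the parameter is $\theta\in\mathbb R^d$, and $\theta_\chi=g_\chi\theta$ for $\chi\in X$. In both cases $Y\sim q_{\theta_*}$ denotes that $Y=\sigma Z+\theta_{*\boldsymbol\chi}$ is drawn from the model with parameter $\theta_*$ (and $\mathbb E_Y$ is expectation under this law), and $$w_\theta(y,\chi)=\frac{g((y-\theta_\chi)/\sigma)}{\mathbb E_{\boldsymbol\chi\sim\rho}[g((y-\theta_{\boldsymbol\chi})/\sigma)]},\qquad L(\theta;\theta_* )=\mathbb E_{Y\sim q_{\theta_*}}\log\mathbb E_{\boldsymbol\chi\sim\rho}\left[g\left(\frac{Y-\theta_{\boldsymbol\chi}}{\sigma}\right)\right],$$ $$Q(\theta'\mid\theta;\theta_* )=-\frac1{2\sigma^2}\mathbb E_{Y\sim q_{\theta_*}}\int_X\|Y-\theta'_\chi\|^2\,w_\theta(Y,\chi)\,\rho(d\chi).$$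 *)

(* Defs.v *)
From HB Require Import structures.
From mathcomp Require Import all_boot all_order all_algebra.
From mathcomp Require Import all_classical all_reals all_analysis.

Set Implicit Arguments.
Unset Strict Implicit.
Unset Printing Implicit Defensive.

Import Order.TTheory GRing.Theory Num.Theory.
Import numFieldNormedType.Exports.

Local Open Scope classical_set_scope.
Local Open Scope ring_scope.

(* The library has no sigma-algebra on ordinals. Only 'I_k.+1 is given one
   because measurable types are nonempty. *)
HB.instance Definition _ (k : nat) := isPointed.Build 'I_k.+1 ord0.
HB.instance Definition _ (k : nat) := @isMeasurable.Build default_measure_display
  'I_k.+1 discrete_measurable
  discrete_measurable0 discrete_measurableC discrete_measurableU.

(* The library norm `|x| on matrices is the sup norm, hence this definition of
   the squared Euclidean norm. *)
Definition sqnorm (R : realType) (d : nat) (x : 'cV[R]_d) : R :=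
  \sum_(i < d) x i ord0 ^+ 2.

(* Matrix of partial derivatives. *)
Definition gradient (R : realType) (m n : nat) (F : 'M[R]_(m, n) -> R)
    (x : 'M[R]_(m, n)) : 'M[R]_(m, n) :=
  \matrix_(i < m, j < n) 'D_(delta_mx i j) F x.

Definition is_argmax (R : realType) (T : Type) (F : T -> R) (x : T) : Prop :=
  forall y, F y <= F x.

Definition orthogonal_group (R : realType) (d : nat) (G : set 'M[R]_d) : Prop :=
  [/\ forall A, G A -> A *m A^T = 1%:M,
      G 1%:M,
      forall A B, G A -> G B -> G (A *m B) &
      forall A, G A -> G (invmx A)].

Section sampling.
Context {R : realType} {d : nat} {dO dX : measure_display}
  {Omega : measurableType dO} {X : measurableType dX}.
Variable P : probability Omega R.

(* Z ~ N(0, I_d): the coordinates of Z are independent N(0, 1) variables. *)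
Definition standard_gaussian (Z : Omega -> 'cV[R]_d) : Prop :=
  (forall i, measurable_fun setT (fun w => Z w i ord0)) /\
  forall A : 'I_d -> set R, (forall i, measurable (A i)) ->
    P [set w | forall i, A i (Z w i ord0)] =
    (\big[*%E/1%E]_(i < d) normal_prob 0 1 (A i))%E.

Definition has_law (chi : Omega -> X) (rho : probability X R) : Prop :=
  measurable_fun setT chi /\
  forall B : set X, measurable B -> P (chi @^-1` B) = rho B.

(* <<s open >> is the Borel sigma-algebra of R^d. *)
Definition independent (Z : Omega -> 'cV[R]_d) (chi : Omega -> X) : Prop :=
  forall (A : set 'cV[R]_d) (B : set X), (<<s open >>) A -> measurable B ->
    P (Z @^-1` A `&` chi @^-1` B) = (P (Z @^-1` A) * P (chi @^-1` B))%E.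

End sampling.

(* [mean theta c] is the vector written theta_c in the model Y = sigma Z +
   theta_chi. *)
Section expectation_maximization.
Context {R : realType} {d : nat} {dO dX : measure_display}
  {Omega : measurableType dO} {X : measurableType dX} {Theta : Type}.
Variables (P : probability Omega R) (rho : probability X R).
Variables (mean : Theta -> X -> 'cV[R]_d) (sigma : R).
Variables (Z : Omega -> 'cV[R]_d) (chi : Omega -> X).

Definition gauss (x : 'cV[R]_d) : R :=
  (2 * pi) `^ (- (d%:R / 2)) * expR (- (sqnorm x / 2)).

Definition component (theta : Theta) (y : 'cV[R]_d) (c : X) : R :=
  gauss (sigma^-1 *: (y - mean theta c)).

Definition mixture (theta : Theta) (y : 'cV[R]_d) : R :=
  \int[rho]_c component theta y c.

Definition weight (theta : Theta) (y : 'cV[R]_d) (c : X) : R :=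
  component theta y c / mixture theta y.

Definition sample (theta_star : Theta) (w : Omega) : 'cV[R]_d :=
  sigma *: Z w + mean theta_star (chi w).

Definition expected_weight (theta theta_star : Theta) (c : X) : R :=
  \int[P]_w weight theta (sample theta_star w) c.

Definition loglik (theta_star theta : Theta) : R :=
  \int[P]_w ln (mixture theta (sample theta_star w)).

(* [surrogate theta_star theta theta'] is Q(theta' | theta; theta_star). *)
Definition surrogate (theta_star theta theta' : Theta) : R :=
  - (2 * sigma ^+ 2)^-1 *
  \int[P]_w \int[rho]_c
    (sqnorm (sample theta_star w - mean theta' c) *
     weight theta (sample theta_star w) c).

End expectation_maximization.

(* The component means are the columns of the parameter. *)
Definition mixture_mean (R : realType) (d k : nat) (theta : 'M[R]_(d, k.+1))
  (c : 'I_k.+1) : 'cV[R]_d := col c theta.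

Definition orbit_mean (R : realType) (d : nat) (X : Type) (g : X -> 'M[R]_d)
  (theta : 'cV[R]_d) (c : X) : 'cV[R]_d := g c *m theta.

Section iterations.
Context {R : realType} {m n : nat}.

Definition gradient_EM (Q : 'M[R]_(m, n) -> 'M[R]_(m, n) -> R) (tau : R)
    (theta_ : nat -> 'M[R]_(m, n)) : Prop :=
  forall t, theta_ t.+1 =
    theta_ t + tau *: gradient (Q (theta_ t)) (theta_ t).

Definition gradient_ascent (L : 'M[R]_(m, n) -> R) (tau : R)
    (theta_ : nat -> 'M[R]_(m, n)) : Prop :=
  forall t, theta_ t.+1 = theta_ t + tau *: gradient L (theta_ t).

End iterations.

(* Main.v *)
(* Write phi for the log-likelihood of one observation y, w for the posterior
   weights at theta and q(theta') for the integrand of Q(theta' | theta).  Then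
   phi(theta') - phi(theta) = ln E_w[exp s], where the gain s satisfies
   E_w[s] = q(theta') - q(theta).  Jensen's inequality and the elementary bound
   ln E[exp s] <= E[s] + 4 (sup |s|)^2, with |s| = O(|theta' - theta| (1 + |y|)),
   give after integration
     0 <= L(theta') - L(theta) - (Q(theta' | theta) - Q(theta | theta))
       <= C |theta' - theta|^2.
   As Q(. | theta) is a quadratic polynomial, L is therefore differentiable at
   theta with the same gradient, without differentiating under the integral.
   In both models the quadratic part of Q is diagonal in the coordinates, so its
   maximizer is found by completing the square. *)
Require Import Defs.
From HB Require Import structures.
From mathcomp Require Import all_boot all_order all_algebra.
From mathcomp Require Import all_classical all_reals all_analysis.
From mathcomp Require Import measurable_realfun ring lra.

Set Implicit Arguments.
Unset Strict Implicit.
Unset Printing Implicit Defensive.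

Import Order.TTheory GRing.Theory Num.Theory.
Import numFieldNormedType.Exports.

Local Open Scope classical_set_scope.
Local Open Scope ring_scope.

(** * Elementary bounds on norms, exponentials and log-expectations *)

Lemma norm_coord_le (R : realType) (m n : nat) (A : 'M[R]_(m, n)) i j :
  `|A i j| <= `|A|.
Proof.
have -> : `|A| = mx_norm A by [].
by rewrite mx_normrE (bigmax_sup (i, j)).
Qed.

(** From exp(-s) >= 1 - s one gets exp(s) <= 1 / (1 - s), and (1 + s + 2 s^2)(1 - s) = 1 + s^2 (1 -
    2 s), which is at least 1 for s <= 1/2. *)
Lemma expR_le_quadratic (R : realType) (s : R) :
  s <= 1 / 2 -> expR s <= 1 + s + 2 * s ^+ 2.
Proof.
move=> s_le; have s1 : 0 < 1 - s by lra.
have : expR s <= (1 - s)^-1.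
  by rewrite -[s in expR s]opprK expRN lef_pV2 ?posrE ?expR_gt0// expR_ge1Dx.
move=> /le_trans; apply; rewrite -[leLHS]mul1r ler_pdivrMr//.
have : 0 <= s ^+ 2 * (1 - 2 * s) by rewrite mulr_ge0 ?sqr_ge0//; lra.
nra.
Qed.

(* Lower bound: Jensen's inequality.  Upper bound: [expR s <= 1 + s + 2 * s ^+ 2]
   when [a <= 1 / 2], and [ln E <= a <= E s + 2 * a] otherwise. *)
Lemma ln_expectation_expR (R : realType) (d : measure_display)
    (X : measurableType d) (rho : {measure set X -> \bar R}) (W s : X -> R)
    (a : R) :
  measurable_fun setT s -> rho.-integrable setT (EFin \o W) ->
  (forall c, 0 <= W c) -> \int[rho]_c W c = 1 -> (forall c, `|s c| <= a) ->
  let E f := \int[rho]_c (f c * W c) in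
  0 < E (expR \o s) /\
  E s <= ln (E (expR \o s)) <= E s + 4 * a ^+ 2.
Proof.
move=> ms iW W0 W1 sa E.
have intE (f : X -> R) (C : R) : measurable_fun setT f ->
    (forall c, `|f c| <= C) -> rho.-integrable setT (fun c => (f c * W c)%:E).
  move=> mf fC; apply: (le_integrable _ _ _ (integrableZl _ C iW)) => //.
    apply/measurable_EFinP/measurable_funM => //.
    by apply/measurable_EFinP; exact: measurable_int iW.
  move=> c _; rewrite -EFinM lee_fin !normrM ler_wpM2r//.
  by rewrite (le_trans (fC c))// ler_norm.
have le_sa c : s c <= a by rewrite (le_trans _ (sa c))// ler_norm.
have ge_sa c : - a <= s c by have := sa c; rewrite ler_norml => /andP[].
have is_ : rho.-integrable setT (fun c => (s c * W c)%:E) by exact: intE sa.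
have ies : rho.-integrable setT (fun c => (expR (s c) * W c)%:E).
  apply: (@intE _ (expR a)); first exact: measurableT_comp.
  by move=> c; rewrite ger0_norm ?expR_ge0// ler_expR.
have icst k : rho.-integrable setT (fun c => (k * W c)%:E).
  by apply: (@intE _ `|k|).
have Ecst k : \int[rho]_c (k * W c) = k by rewrite RintegralZl// W1 mulr1.
have E_ge (k : R) f : rho.-integrable setT (fun c => (f c * W c)%:E) ->
    (forall c, k <= f c) -> k <= E f.
  move=> fi kf; rewrite -[leLHS]Ecst.
  apply: (le_Rintegral _ (icst k) fi) => // c _.
  by rewrite ler_wpM2r.
have E_le (k : R) f : rho.-integrable setT (fun c => (f c * W c)%:E) ->
    (forall c, f c <= k) -> E f <= k.
  move=> fi kf; rewrite -[leRHS]Ecst.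
  apply: (le_Rintegral _ fi (icst k)) => // c _.
  by rewrite ler_wpM2r.
have E0 : 0 < E (expR \o s).
  apply: (@lt_le_trans _ _ (expR (- a))); first exact: expR_gt0.
  by apply: E_ge => // c /=; rewrite ler_expR.
(* Both bounds compare exp(s) with an affine function of [s], whose expectation is explicit. *)
have Eaff (p q : R) : rho.-integrable setT (fun c => ((p + q * s c) * W c)%:E) /\
    E (fun c => p + q * s c) = p + q * E s.
  have iqs : rho.-integrable setT (fun c => (q * (s c * W c))%:E).
    by under eq_fun do rewrite EFinM; exact: integrableZl.
  split.
    under eq_fun do rewrite mulrDl -mulrA EFinD.
    exact: (integrableD _ (icst p) iqs).
  rewrite /E; under eq_Rintegral do rewrite mulrDl -mulrA.
  by rewrite (RintegralD _ (icst p) iqs)// Ecst RintegralZl.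
split => //; apply/andP; split.
  rewrite -ler_expR lnK ?posrE//.
  (* This affine function is the tangent of exp at [E s]; it lies below exp and its expectation is
     [expR (E s)]. *)
  have [ia Ea] := Eaff (expR (E s) * (1 - E s)) (expR (E s)).
  have -> : expR (E s) = E (fun c => expR (E s) * (1 - E s) + expR (E s) * s c).
    by rewrite Ea; ring.
  apply: le_Rintegral => // c _ /=; rewrite ler_wpM2r//.
  have -> : expR (s c) = expR (E s) * expR (s c - E s).
    by rewrite -expRD addrC subrK.
  rewrite -mulrDr ler_wpM2l ?expR_ge0//.
  by apply: le_trans (expR_ge1Dx _); rewrite addrAC addrA.
have [a2|a2] := leP a (1 / 2).
  have [ia Ea] := Eaff (1 + 2 * a ^+ 2) 1.
  apply: (@le_trans _ _ (E s + 2 * a ^+ 2)); last by have := sqr_ge0 a; lra.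
  rewrite -ler_expR lnK ?posrE//.
  apply: (@le_trans _ _ (1 + (E s + 2 * a ^+ 2))); last exact: expR_ge1Dx.
  have -> : 1 + (E s + 2 * a ^+ 2) = E (fun c => 1 + 2 * a ^+ 2 + 1 * s c).
    by rewrite Ea; ring.
  apply: le_Rintegral => // c _ /=; rewrite ler_wpM2r//.
  apply: le_trans (expR_le_quadratic _) _; first by have := le_sa c; lra.
  have : s c ^+ 2 <= a ^+ 2.
    by rewrite -real_normK ?num_real// lerXn2r ?nnegrE// (le_trans _ (sa c)).
  lra.
(* For [a > 1 / 2] crude bounds suffice, because then [2 * a <= 4 * a ^+ 2]. *)
have Ea : - a <= E s by exact: E_ge.
have : ln (E (expR \o s)) <= a.
  rewrite -ler_expR lnK ?posrE//; apply: E_le => // c /=.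
  by rewrite ler_expR.
nra.
Qed.

(** * Gradients and maximizers read off from increments *)

Lemma gradient_eq_of_quadratic_remainder (R : realType) (m n : nat)
    (F : 'M[R]_(m, n) -> R) (x V : 'M[R]_(m, n)) (C : R) :
  (forall h : 'M[R]_(m, n), `|h| <= 1 ->
    `|F (x + h) - F x - \sum_i \sum_j V i j * h i j| <= C * `|h| ^+ 2) ->
  differentiable F x /\ gradient F x = V.
Proof.
move=> FC.
pose l (h : 'M[R]_(m, n)) : R := \sum_i \sum_j V i j * h i j.
have l_lin : linear l.
  move=> k u v; rewrite /l scaler_sumr -big_split; apply: eq_bigr => i _ /=.
  rewrite scaler_sumr -big_split; apply: eq_bigr => j _ /=.
  by rewrite !mxE mulrDr mulrCA.
pose l_mixin := GRing.isLinear.Build R 'M[R]_(m, n) R^o *:%R l l_lin.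
pose L : {linear 'M[R]_(m, n) -> R^o} := HB.pack l l_mixin.
have cL : continuous L.
  apply: bounded_linear_continuous; apply/linear_boundedP.
  near=> r => h.
  have -> : L h = l h by [].
  apply: (@le_trans _ _ ((\sum_i \sum_j `|V i j|) * `|h|)).
    rewrite /l (le_trans (ler_norm_sum _ _ _))// mulr_suml ler_sum// => i _.
    rewrite (le_trans (ler_norm_sum _ _ _))// mulr_suml ler_sum// => j _.
    by rewrite normrM ler_wpM2l//; exact: norm_coord_le.
  by rewrite ler_wpM2r//; near: r; apply: nbhs_pinfty_ge; rewrite num_real.
(* The little-o condition: C |h|^2 <= e |h| as soon as |h| <= e / (|C| + 1). The denominator is
   positive whatever the sign of [C]. *)
have F_near (e : R) : 0 < e -> \forall h \near (0 : 'M[R]_(m, n)),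
    `|F (h + x) - (F x + L h)| <= e * `|h|.
  move=> e0; near=> h.
  have h1 : `|h| <= 1 by near: h; exact: (@nbhs0_le R 'M[R]_(m, n) _ ltr01).
  have hC : `|h| <= e / (`|C| + 1).
    near: h; apply: (@nbhs0_le R 'M[R]_(m, n)).
    by rewrite divr_gt0// ltr_wpDl.
  rewrite opprD addrA addrC [h + x]addrC [- L h + _]addrC.
  apply: le_trans (FC h h1) _.
  rewrite expr2 mulrA ler_wpM2r//.
  apply: (@le_trans _ _ ((`|C| + 1) * `|h|)).
    by rewrite ler_wpM2r// (le_trans (ler_norm C))// lerDl.
  by rewrite mulrC -ler_pdivlMr// ltr_wpDl.
pose F' : 'M[R]_(m, n) -> R^o := F.
have F_o := (@eqaddoP R 'M[R]_(m, n) R^o 'M[R]_(m, n)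
  (nbhs_filter_on (0 : 'M[R]_(m, n))) (F' \o shift x) (cst (F' x) + L) id).2 F_near.
(* By uniqueness of the differential, the partial derivatives are the values of [L] at the matrices
   [delta_mx i j], namely the entries of [V]. *)
have dF := diff_unique cL F_o.
have dFx : differentiable F x by apply/diff_locallyP; rewrite dF.
split => //; apply/matrixP => i j; rewrite mxE deriveE// dF.
have -> : L (delta_mx i j) = l (delta_mx i j) by [].
rewrite /l (bigD1 i)//= (bigD1 j)//= mxE !eqxx mulr1 !big1 ?addr0// => [i' ni|j' nj].
  by rewrite big1// => j' _; rewrite mxE (negbTE ni) mulr0.
by rewrite mxE (negbTE nj) andbF mulr0.
Unshelve. all: by end_near. Qed.

(** Completing the square in each coordinate gives [F best - F u] as a sum of terms
    [B i j / 2 * (u i j - best i j) ^+ 2]. It is nonnegative, and it vanishes only at [u = best]. *)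
Lemma argmax_of_quadratic_increment (R : realType) (m n : nat)
    (F : 'M[R]_(m, n) -> R) (x V B y : 'M[R]_(m, n)) :
  (forall i j, 0 < B i j) ->
  (forall h, F (x + h) - F x =
    \sum_i \sum_j (V i j * h i j - B i j / 2 * h i j ^+ 2)) ->
  is_argmax F y <-> forall i j, y i j = x i j + V i j / B i j.
Proof.
move=> B_gt0 F_incr.
pose best := x + \matrix_(i, j) (V i j / B i j).
have bestE i j : best i j = x i j + V i j / B i j by rewrite !mxE.
have incrE v : F v - F x =
    \sum_i \sum_j (V i j * (v - x) i j - B i j / 2 * (v - x) i j ^+ 2).
  by rewrite -F_incr subrKC.
have square u : F best - F u =
    \sum_i \sum_j B i j / 2 * (u i j - best i j) ^+ 2.
  have -> : F best - F u = (F best - F x) - (F u - F x) by ring.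
  rewrite !incrE -sumrB.
  apply: eq_bigr => i _; rewrite -sumrB; apply: eq_bigr => j _.
  by rewrite !mxE; field; rewrite gt_eqF.
have sq_ge0 u i j : 0 <= B i j / 2 * (u i j - best i j) ^+ 2.
  by rewrite mulr_ge0 ?sqr_ge0// divr_ge0// ltW.
split => [amax i j|yE u].
  have : F best - F y <= 0 by rewrite subr_le0.
  rewrite square => sum_le0.
  have /eqP : \sum_i \sum_j B i j / 2 * (y i j - best i j) ^+ 2 = 0.
    apply/eqP; rewrite eq_le sum_le0 /=.
    by apply: sumr_ge0 => i' _; apply: sumr_ge0 => j' _.
  rewrite psumr_eq0 => [/allP/(_ i (mem_index_enum _))/=|i' _]; last first.
    by apply: sumr_ge0 => j' _.
  rewrite psumr_eq0// => /allP/(_ j (mem_index_enum _))/=.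
  rewrite mulf_eq0 gt_eqF ?divr_gt0//= sqrf_eq0 subr_eq0 bestE.
  by move/eqP.
have -> : y = best by apply/matrixP => i j; rewrite yE bestE.
rewrite -subr_ge0 square.
by apply: sumr_ge0 => i' _; apply: sumr_ge0 => j' _.
Qed.

(** * Second moment of the Gaussian noise *)

Section normal_second_moment.
Context {R : realType}.
Local Notation mu := (@lebesgue_measure R).
Local Notation N01 := (@normal_prob R 0 1).

(** The change of variables formula involves the Radon-Nikodym derivative of [normal_prob]. That
    derivative and the density have the same integral over every measurable set, so they agree
    almost everywhere. *)
Lemma ge0_integral_normal_prob (f : R -> \bar R) : measurable_fun setT f ->
  (forall x, 0 <= f x)%E ->
  (\int[N01]_x f x = \int[mu]_x (f x * (normal_pdf 0 1 x)%:E))%E.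
Proof.
move=> mf f0.
have dom := @normal_prob_dominates R 0 1.
have RNi := Radon_Nikodym_SigmaFinite.f_integrable dom.
rewrite -(Radon_Nikodym_SigmaFinite.change_of_variables dom f0 measurableT mf).
have mpdf : measurable_fun setT (EFin \o (@normal_pdf R 0 1)).
  by apply/measurable_EFinP; exact: measurable_normal_pdf.
apply: ae_eq_integral => //.
- by apply: emeasurable_funM => //; exact: measurable_int RNi.
- exact: emeasurable_funM.
- apply: ae_eqe_mul2l; apply: integral_ae_eq => // E _ mE.
  by rewrite -Radon_Nikodym_SigmaFinite.f_integral.
Qed.

(** Since x^2 / 4 <= exp(x^2 / 4), one has x^2 exp(-x^2 / 2) <= 4 exp(-x^2 / 4). The right side is a
    multiple of the density of N(0, 2), which has integral 1; [k] collects the 4 and the ratio of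
    the normalizing constants. *)
Lemma normal_prob_integrable_sqr : N01.-integrable setT (fun x => (x ^+ 2)%:E).
Proof.
have msq : measurable_fun setT (fun x : R => x ^+ 2) by exact: measurable_funX.
apply/integrableP; split; first exact/measurable_EFinP.
under eq_integral do rewrite gee0_abs ?lee_fin ?sqr_ge0//.
rewrite ge0_integral_normal_prob; last 2 first.
- exact/measurable_EFinP.
- by move=> x; rewrite lee_fin sqr_ge0.
pose r : R := Num.sqrt 2.
have r2 : r ^+ 2 = 2 by rewrite sqr_sqrtr.
have r0 : r != 0 by rewrite sqrtr_eq0 -ltNge.
pose k : R := 4 * normal_peak 1 / normal_peak r.
have k0 : 0 <= k by rewrite divr_ge0 ?mulr_ge0 ?normal_peak_ge0.
apply: (@le_lt_trans _ _ (\int[mu]_x (k%:E * (normal_pdf 0 r x)%:E))%E).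
  apply: ge0_le_integral => //=.
  - by move=> x _; rewrite mule_ge0 ?lee_fin ?sqr_ge0 ?normal_pdf_ge0.
  - by apply/measurable_EFinP/measurable_funM => //; exact: measurable_normal_pdf.
  - by apply/measurable_EFinP/measurable_funM => //; exact: measurable_normal_pdf.
  - move=> x _; rewrite -!EFinM lee_fin !normal_pdfE ?oner_eq0//.
    have -> : k * (normal_peak r * normal_fun 0 r x) =
        4 * normal_peak 1 * normal_fun 0 r x.
      by rewrite /k mulrA divfK// gt_eqF// normal_peak_gt0.
    rewrite mulrCA [4 * _]mulrC -[leRHS]mulrA ler_wpM2l ?normal_peak_ge0//.
    rewrite /normal_fun subr0 expr1n r2.
    have -> : - x ^+ 2 / (1 *+ 2) = - x ^+ 2 / (2 *+ 2) + - (x ^+ 2 / 4) by field.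
    rewrite expRD expRN mulrCA mulrC ler_wpM2r ?expR_ge0//.
    rewrite ler_pdivrMr ?expR_gt0//.
    have := expR_ge1Dx (x ^+ 2 / 4); lra.
rewrite integralZl//; last exact: integrable_normal_pdf.
by rewrite integral_normal_pdf mule1 ltry.
Qed.

End normal_second_moment.

Lemma standard_gaussian_integrable_sqr (R : realType) (d : nat)
    (dO : measure_display) (Omega : measurableType dO) (P : probability Omega R)
    (Z : Omega -> 'cV[R]_d) (i : 'I_d) :
  standard_gaussian P Z -> P.-integrable setT (fun w => (Z w i ord0 ^+ 2)%:E).
Proof.
move=> [mZ lawZ].
pose f : Omega -> measurableTypeR R := fun w => Z w i ord0.
have mf : measurable_fun setT f by exact: mZ.
have msq : measurable_fun setT (fun x : measurableTypeR R => (x ^+ 2)%:E).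
  by apply/measurable_EFinP; exact: measurable_funX.
apply/integrableP; split.
  by apply/measurable_EFinP/measurable_funX; exact: mZ.
under eq_integral do rewrite gee0_abs ?lee_fin ?sqr_ge0//.
have := ge0_integral_pushforward mf P (@measurableT _ _) msq.
rewrite preimage_setT => <-; last by move=> x _; rewrite lee_fin sqr_ge0.
have -> : (\int[pushforward P f]_x (x ^+ 2)%:E =
           \int[@normal_prob R 0 1]_x (x ^+ 2)%:E)%E.
  apply: (@eq_measure_integral _ _ _ setT (@normal_prob R 0 1)
    (measure_function_pushforward__canonical__measure_function_Measure P mf)).
  move=> A mA _; rewrite /= /pushforward.
  (* The law of coordinate [i] is the product formula with the whole line in all other coordinates,
     each contributing a factor 1. *)
  pose B (j : 'I_d) : set R := if j == i then A else setT.
  have mB j : measurable (B j) by rewrite /B; case: ifP.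
  have -> : f @^-1` A = [set w | forall j, B j (Z w j ord0)].
    apply/seteqP; split => w /=.
      by move=> Aw j; rewrite /B; case: eqP => // ->.
    by move=> /(_ i); rewrite /B eqxx.
  rewrite lawZ// (bigD1 i)//= big1 ?mule1; first by rewrite /B eqxx.
  move=> j ji; rewrite /B (negbTE ji).
  by rewrite /normal_prob integral_normal_pdf.
have /integrableP[_] := @normal_prob_integrable_sqr R.
by under eq_integral do rewrite gee0_abs ?lee_fin ?sqr_ge0//.
Qed.

(** * The EM identities for component means that are linear in the parameter *)

Section em_core.
Context {R : realType} {m n d : nat} {dO dX : measure_display}
  {Omega : measurableType dO} {X : measurableType dX}.
Variables (P : probability Omega R) (rho : probability X R).
Variables (mean : 'M[R]_(m, n) -> X -> 'cV[R]_d) (sigma : R).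
Variables (Z : Omega -> 'cV[R]_d) (chi : Omega -> X).
Variables (theta_star : 'M[R]_(m, n)) (M : R) (b : 'M[R]_(m, n) -> 'M[R]_(m, n)).

Local Notation Y := (sample mean sigma Z chi theta_star).
Local Notation wt := (weight rho mean sigma).
Local Notation L := (loglik P rho mean sigma Z chi theta_star).
Local Notation Q := (surrogate P rho mean sigma Z chi theta_star).

Hypotheses (sigma_gt0 : 0 < sigma) (M_ge0 : 0 <= M).
Hypothesis mean_linear : forall k u v c,
  mean (k *: u + v) c = k *: mean u c + mean v c.
Hypothesis mean_bounded : forall h c i, `|mean h c i ord0| <= M * `|h|.
Hypothesis measurable_mean : forall h i,
  measurable_fun setT (fun c => mean h c i ord0).
Hypothesis measurable_Y : forall i, measurable_fun setT (fun w => Y w i ord0).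
Hypothesis integrable_sqrY : forall i,
  P.-integrable setT (fun w => (Y w i ord0 ^+ 2)%:E).

(** [N y] dominates both 1 and every coordinate of [y], so estimates affine in |y| become multiples
    of [N y], and [N (Y w) ^+ 2] is integrable. *)
Let N (y : 'cV[R]_d) : R := Num.sqrt (1 + sqnorm y).

Let sqnorm_ge0 (y : 'cV[R]_d) : 0 <= sqnorm y.
Proof. by apply: sumr_ge0 => i _; exact: sqr_ge0. Qed.

Let N_sqr y : N y ^+ 2 = 1 + sqnorm y.
Proof. by rewrite sqr_sqrtr// addr_ge0. Qed.

Let N_ge1 y : 1 <= N y.
Proof. by rewrite -[leLHS]sqrtr1 ler_wsqrtr// lerDl. Qed.

Let N_ge0 y : 0 <= N y. Proof. exact: sqrtr_ge0. Qed.

Let coord_le_N (y : 'cV[R]_d) i : `|y i ord0| <= N y.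
Proof.
rewrite -sqrtr_sqr ler_wsqrtr// /sqnorm (bigD1 i)//= addrCA lerDl.
by rewrite addr_ge0// sumr_ge0// => j _; exact: sqr_ge0.
Qed.

Let integrable_N2 : P.-integrable setT (fun w => (N (Y w) ^+ 2)%:E).
Proof.
under eq_fun do rewrite N_sqr EFinD /sqnorm -sumEFin.
apply: integrableD => //; first exact: finite_measure_integrable_cst.
exact: integrable_sum.
Qed.

Section fixed_parameter.
Variable theta : 'M[R]_(m, n).

Let T := 1 + M * `|theta|.

Let T_ge1 : 1 <= T. Proof. by rewrite lerDl mulr_ge0. Qed.

(** The coordinate of [y] is at most [N y], and the bound on the mean may be multiplied by [N y]
    because [1 <= N y]. *)
Lemma coordB_le y c i : `|(y - mean theta c) i ord0| <= N y * T.
Proof.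
rewrite !mxE (le_trans (ler_normB _ _))// mulrDr mulr1 lerD//.
by rewrite (le_trans (mean_bounded _ _ _))// ler_peMl ?mulr_ge0.
Qed.

Lemma sqnormB_le y c : sqnorm (y - mean theta c) <= d%:R * T ^+ 2 * N y ^+ 2.
Proof.
have -> : d%:R * T ^+ 2 * N y ^+ 2 = \sum_(i < d) (T * N y) ^+ 2.
  rewrite sumr_const card_ord -[RHS]mulr_natl exprMn.
  by rewrite [RHS]mulrA.
apply: ler_sum => i _; rewrite -real_normK ?num_real//.
by rewrite lerXn2r ?nnegrE ?mulr_ge0// ?(le_trans _ T_ge1)// mulrC coordB_le.
Qed.

Let measurable_sqnormB y :
  measurable_fun setT (fun c => sqnorm (y - mean theta c)).
Proof.
apply: measurable_sum => i; apply: measurable_funX.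
by under eq_fun do rewrite !mxE; exact: measurable_funB.
Qed.

Lemma measurable_coordB i :
  measurable_fun setT (fun p : Omega * X => (Y p.1 - mean theta p.2) i ord0).
Proof.
have coordB (u v : 'cV[R]_d) : (u - v) i ord0 = u i ord0 - v i ord0.
  by rewrite !mxE.
under eq_fun do rewrite coordB.
apply: measurable_funB.
  exact: (measurableT_comp (measurable_Y i) measurable_fst).
exact: (measurableT_comp (measurable_mean theta i) measurable_snd).
Qed.

Let K : R := (2 * pi) `^ (- (d%:R / 2)).

Let K_gt0 : 0 < K. Proof. by rewrite powR_gt0// mulr_gt0// pi_gt0. Qed.

Lemma componentE y c : component mean sigma theta y c =
  K * expR (- (sqnorm (y - mean theta c) / (2 * sigma ^+ 2))).
Proof.
rewrite /component /gauss; congr (_ * expR (- _)).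
have -> (x : 'cV[R]_d) : sqnorm (sigma^-1 *: x) = sigma ^- 2 * sqnorm x.
  by rewrite mulr_sumr; apply: eq_bigr => i _; rewrite mxE exprMn exprVn.
by field; rewrite gt_eqF.
Qed.

Lemma component_gt0 y c : 0 < component mean sigma theta y c.
Proof. by rewrite componentE mulr_gt0// expR_gt0. Qed.

Let component_le y c : component mean sigma theta y c <= K.
Proof.
rewrite componentE ler_piMr ?(ltW K_gt0)// expR_le1 oppr_le0 divr_ge0//.
by rewrite mulr_ge0// sqr_ge0.
Qed.

Let measurable_component y : measurable_fun setT (component mean sigma theta y).
Proof.
rewrite (funext (componentE y)).
apply: measurable_funM => //; apply: measurableT_comp => //.
by apply: measurableT_comp => //; exact: measurable_funM.
Qed.

Lemma integrable_component y :
  rho.-integrable setT (EFin \o component mean sigma theta y).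
Proof.
apply: (le_integrable _ _ _
  (finite_measure_integrable_cst rho K measurableT)) => //.
  exact/measurable_EFinP.
move=> c _; rewrite /= lee_fin gtr0_norm ?component_gt0//.
rewrite (le_trans (component_le y c))//.
exact: ler_norm.
Qed.

(** Every component is at least [lower y], hence so is the mixture. Positivity makes the weights
    genuine quotients, and ln of [lower y] is only quadratic in [N y]. *)
Let lower y := K * expR (- (d%:R * T ^+ 2 * N y ^+ 2 / (2 * sigma ^+ 2))).

Let lower_gt0 y : 0 < lower y. Proof. by rewrite mulr_gt0// expR_gt0. Qed.

Let Rint_cst (r : R) : \int[rho]_c r = r.
Proof.
rewrite Rintegral_cst//.
have -> : fine (rho [set: X]) = 1 by rewrite probability_setT.
by rewrite mulr1.
Qed.

Let mixture_bounds y : lower y <= mixture rho mean sigma theta y <= K.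
Proof.
apply/andP; split.
  rewrite -[leLHS]Rint_cst; apply: le_Rintegral => //.
  - exact: finite_measure_integrable_cst.
  - exact: integrable_component.
  move=> c _; rewrite componentE ler_wpM2l ?(ltW K_gt0)// ler_expR lerN2.
  by rewrite ler_wpM2r ?sqnormB_le// invr_ge0 mulr_ge0// sqr_ge0.
rewrite -[leRHS]Rint_cst; apply: le_Rintegral => //.
- exact: integrable_component.
- exact: finite_measure_integrable_cst.
Qed.

Lemma mixture_gt0 y : 0 < mixture rho mean sigma theta y.
Proof. by have /andP[/(lt_le_trans (lower_gt0 y))] := mixture_bounds y. Qed.

Lemma weight_gt0 y c : 0 < wt theta y c.
Proof. by rewrite divr_gt0 ?mixture_gt0 ?component_gt0. Qed.

Let weightE y : wt theta y =
  fun c => (mixture rho mean sigma theta y)^-1 * component mean sigma theta y c.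
Proof. by apply/funext => c; rewrite mulrC. Qed.

Lemma integrable_weight y : rho.-integrable setT (EFin \o wt theta y).
Proof.
rewrite weightE; exact: (integrableZl _ _ (integrable_component y)).
Qed.

Lemma Rintegral_weight y : \int[rho]_c wt theta y c = 1.
Proof.
rewrite weightE RintegralZl ?mulVf//; last exact: integrable_component.
by rewrite gt_eqF// mixture_gt0.
Qed.

Lemma measurable_component_prod : measurable_fun setT
  (fun p : Omega * X => component mean sigma theta (Y p.1) p.2).
Proof.
under eq_fun do rewrite componentE.
apply: measurable_funM => //; apply: measurableT_comp => //.
apply: measurableT_comp => //; apply: measurable_funM => //.
apply: measurable_sum => i; apply: measurable_funX; exact: measurable_coordB.
Qed.

Lemma measurable_mixture :
  measurable_fun setT (fun w => mixture rho mean sigma theta (Y w)).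
Proof.
apply: measurableT_comp => //.
apply: (@measurable_fun_fubini_tonelli_F _ _ _ _ _ rho
  (fun p => (component mean sigma theta (Y p.1) p.2)%:E)) => /=.
  by apply/measurable_EFinP; exact: measurable_component_prod.
by move=> p; rewrite lee_fin ltW// component_gt0.
Qed.

Lemma measurable_weight_prod :
  measurable_fun setT (fun p : Omega * X => wt theta (Y p.1) p.2).
Proof.
(* The mixture is positive, so its inverse can be written as exp(-ln), a composition of measurable
   functions. *)
rewrite (_ : (fun _ => _) = fun p => component mean sigma theta (Y p.1) p.2 *
    expR (- ln (mixture rho mean sigma theta (Y p.1)))); last first.
  by apply/funext => p; rewrite expRN lnK// posrE mixture_gt0.
apply: measurable_funM; first exact: measurable_component_prod.
apply: measurableT_comp => //; apply: measurableT_comp => //.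
apply: measurableT_comp => //.
exact: (measurableT_comp measurable_mixture measurable_fst).
Qed.

(** The logarithm lies between ln K - D N^2 and ln K, where N^2 >= 1, so its absolute value is at
    most [C] times the integrable N^2. *)
Lemma integrable_ln_mixture :
  P.-integrable setT (fun w => (ln (mixture rho mean sigma theta (Y w)))%:E).
Proof.
pose C := `|ln K| + d%:R * T ^+ 2 / (2 * sigma ^+ 2).
apply: (le_integrable _ _ _ (integrableZl _ C integrable_N2)) => //.
  apply/measurable_EFinP; apply: measurableT_comp => //.
  exact: measurable_mixture.
move=> w _; rewrite -EFinM lee_fin; set y := Y w.
have N2 : 1 <= N y ^+ 2 by rewrite exprn_ege1.
set D := d%:R * T ^+ 2 / (2 * sigma ^+ 2).
have D0 : 0 <= D.
  by rewrite divr_ge0// mulr_ge0// sqr_ge0.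
have := mixture_bounds y => /andP[lo up].
have : ln (lower y) <= ln (mixture rho mean sigma theta y).
  by rewrite ler_ln ?posrE ?mixture_gt0.
have : ln (mixture rho mean sigma theta y) <= ln K.
  by rewrite ler_ln ?posrE ?mixture_gt0.
rewrite /lower lnM ?posrE ?expR_gt0// expRK.
have -> : d%:R * T ^+ 2 * N y ^+ 2 / (2 * sigma ^+ 2) = D * N y ^+ 2.
  by rewrite /D mulrAC.
move=> h1 h2.
have C0 : 0 <= C by rewrite addr_ge0.
rewrite [leRHS]ger0_norm ?mulr_ge0 ?sqr_ge0// /C -/D ler_norml.
have k1 := ler_norm (ln K).
have k2 : - `|ln K| <= ln K by rewrite lerNl (le_trans (ler_norm _))// normrN.
have k3 : `|ln K| <= `|ln K| * N y ^+ 2 by rewrite ler_peMr.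
have k4 : 0 <= D * N y ^+ 2 by rewrite mulr_ge0// sqr_ge0.
rewrite mulrDl; apply/andP; split; lra.
Qed.

(** The class of integrands to which Fubini applies. The bound is uniform in [c], so it survives
    averaging over the weights, and the second moment of [Y] then makes it integrable. *)
Definition quadratic_growth (F : Omega -> X -> R) : Prop :=
  measurable_fun setT (fun p : Omega * X => F p.1 p.2) /\
  exists C, forall w c, `|F w c| <= C * (1 + sqnorm (Y w)).

Definition posterior_mean (F : Omega -> X -> R) (w : Omega) : R :=
  \int[rho]_c (F w c * wt theta (Y w) c).

Lemma integrable_posterior F w : quadratic_growth F ->
  rho.-integrable setT (fun c => (F w c * wt theta (Y w) c)%:E).
Proof.
move=> [mF [C FC]].
apply: (le_integrable _ _ _ (integrableZl _ (C * N (Y w) ^+ 2)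
  (integrable_weight (Y w)))) => //.
  apply/measurable_EFinP/measurable_funM.
    exact: (measurableT_comp mF (measurable_pair1 w)).
  by apply/measurable_EFinP; exact: measurable_int (integrable_weight (Y w)).
move=> c _; rewrite -EFinM lee_fin [leLHS]normrM [leRHS]normrM ler_wpM2r//.
by rewrite (le_trans (FC w c))// -N_sqr ler_norm.
Qed.

Lemma integrable_posterior_mean F : quadratic_growth F ->
  P.-integrable setT (EFin \o posterior_mean F).
Proof.
move=> gF; have [mF [C FC]] := gF.
pose G (p : Omega * X) := (F p.1 p.2 * wt theta (Y p.1) p.2)%:E.
have mG : measurable_fun setT G.
  apply/measurable_EFinP/measurable_funM => //; exact: measurable_weight_prod.
have iG : (P \x rho)%E.-integrable setT G.
  apply/integrable12ltyP => //.
  apply: (@le_lt_trans _ _ (\int[P]_w (`|C| * N (Y w) ^+ 2)%:E)%E).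
    apply: ge0_le_integral => //.
    - by move=> w _; exact: integral_ge0.
    - apply: (@measurable_fun_fubini_tonelli_F _ _ _ _ _ rho (abse \o G)).
        exact: measurableT_comp.
      by move=> p; exact: abse_ge0.
    - apply/measurable_EFinP/measurable_funM => //.
      by apply/measurable_EFinP; exact: measurable_int integrable_N2.
    - move=> w _.
      (* The total mass 1 of the weights is inserted on the right, so that the two integrals over
         [c] can be compared pointwise. *)
      rewrite -[leRHS]mule1 -(Rintegral_weight (Y w)) fineK; last first.
        exact: integrable_fin_num (integrable_weight _).
      rewrite -integralZl//; last exact: integrable_weight.
      apply: ge0_le_integral.
      + exact: measurableT.
      + by move=> c _; exact: abse_ge0.
      + have := measurable_int _ (integrable_posterior w gF).
        exact: measurableT_comp.
      + exact: measurable_funeM (measurable_int _ (integrable_weight (Y w))).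
      + move=> c _; rewrite -EFinM lee_fin normrM [X in _ * X]gtr0_norm ?weight_gt0//.
        rewrite ler_wpM2r// ?(ltW (weight_gt0 _ _))//.
        by rewrite (le_trans (FC w c))// -N_sqr ler_wpM2r ?sqr_ge0// ler_norm.
  under eq_integral do rewrite EFinM.
  rewrite integralZl//.
  by rewrite lte_mul_pinfty// ltey_eq (integrable_fin_num _ integrable_N2).
have := integrable_fubini_F iG.
apply: eq_integrable => // w _.
rewrite /= /posterior_mean /Rintegral fineK//.
exact: integrable_fin_num (integrable_posterior w gF).
Qed.

End fixed_parameter.
Lemma quadratic_growth_cst (k : R) : quadratic_growth (fun _ _ => k).
Proof.
split; first exact: measurable_cst.
exists `|k| => w c; rewrite -N_sqr ler_peMr// exprn_ege1//.
Qed.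

Lemma quadratic_growthD F G : quadratic_growth F -> quadratic_growth G ->
  quadratic_growth (fun w c => F w c + G w c).
Proof.
move=> [mF [C FC]] [mG [D GD]]; split; first exact: measurable_funD.
exists (C + D) => w c; rewrite (le_trans (ler_normD _ _))// mulrDl lerD//.
Qed.

Lemma quadratic_growthZ (k : R) F : quadratic_growth F ->
  quadratic_growth (fun w c => k * F w c).
Proof.
move=> [mF [C FC]]; split; first exact: measurable_funM.
by exists (`|k| * C) => w c; rewrite normrM -mulrA ler_wpM2l.
Qed.

Lemma quadratic_growth_sum (I : Type) (s : seq I) (F : I -> Omega -> X -> R) :
  (forall i, quadratic_growth (F i)) ->
  quadratic_growth (fun w c => \sum_(i <- s) F i w c).
Proof.
move=> gF; elim: s => [|i s IH].
  have -> : (fun w c => \sum_(i <- [::]) F i w c) = fun _ _ => 0.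
    by apply/funext => w; apply/funext => c; rewrite big_nil.
  exact: quadratic_growth_cst.
have -> : (fun w c => \sum_(j <- i :: s) F j w c) =
    fun w c => F i w c + \sum_(j <- s) F j w c.
  by apply/funext => w; apply/funext => c; rewrite big_cons.
exact: quadratic_growthD.
Qed.

(** Up to the factor [- (2 * sigma ^+ 2)^-1], the surrogate is this functional at the squared
    distance. Its linearity on integrands of quadratic growth carries all the algebra of Q below. *)
Definition posterior_expectation (theta : 'M[R]_(m, n)) F : R :=
  \int[P]_w posterior_mean theta F w.

Local Notation E := posterior_expectation.

Lemma posterior_meanD theta F G w : quadratic_growth F -> quadratic_growth G ->
  posterior_mean theta (fun w c => F w c + G w c) w =
  posterior_mean theta F w + posterior_mean theta G w.
Proof.
move=> gF gG; rewrite /posterior_mean.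
under eq_Rintegral do rewrite mulrDl.
exact: (RintegralD measurableT (integrable_posterior theta w gF)
  (integrable_posterior theta w gG)).
Qed.

Lemma posterior_meanZ theta k F w : quadratic_growth F ->
  posterior_mean theta (fun w c => k * F w c) w = k * posterior_mean theta F w.
Proof.
move=> gF; rewrite /posterior_mean.
under eq_Rintegral do rewrite -mulrA.
exact: (RintegralZl _ measurableT (integrable_posterior theta w gF)).
Qed.

Lemma posterior_expectationD theta F G :
  quadratic_growth F -> quadratic_growth G ->
  E theta (fun w c => F w c + G w c) = E theta F + E theta G.
Proof.
move=> gF gG; rewrite /E.
under eq_Rintegral do rewrite posterior_meanD//.
exact: (RintegralD measurableT (integrable_posterior_mean theta gF)
  (integrable_posterior_mean theta gG)).
Qed.

Lemma posterior_expectationZ theta k F : quadratic_growth F ->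
  E theta (fun w c => k * F w c) = k * E theta F.
Proof.
move=> gF; rewrite /E.
under eq_Rintegral do rewrite posterior_meanZ//.
exact: (RintegralZl _ measurableT (integrable_posterior_mean theta gF)).
Qed.

Lemma posterior_expectation_sum theta (I : Type) (s : seq I)
    (F : I -> Omega -> X -> R) :
  (forall i, quadratic_growth (F i)) ->
  E theta (fun w c => \sum_(i <- s) F i w c) = \sum_(i <- s) E theta (F i).
Proof.
move=> gF; elim: s => [|i s IH].
  (* Writing the empty sum as [0 * 0] lets the scaling rule yield the value 0. *)
  have -> : (fun w c => \sum_(i <- [::]) F i w c) = fun _ _ => 0 * 0.
    by apply/funext => w; apply/funext => c; rewrite big_nil mul0r.
  rewrite (posterior_expectationZ _ _ (quadratic_growth_cst 0)) mul0r.
  by rewrite big_nil.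
rewrite big_cons -IH -(posterior_expectationD _ (gF i)
  (quadratic_growth_sum s gF)).
congr (E theta _); apply/funext => w; apply/funext => c; exact: big_cons.
Qed.

Let meanD u v c : mean (u + v) c = mean u c + mean v c.
Proof. by have := mean_linear 1 u v c; rewrite !scale1r. Qed.

Let mean_coord (h : 'M[R]_(m, n)) c l :
  mean h c l ord0 = \sum_i \sum_j h i j * mean (delta_mx i j) c l ord0.
Proof.
pose f_mixin := GRing.isLinear.Build R 'M[R]_(m, n) 'cV[R]_d *:%R (mean^~ c)
  (fun k u v => mean_linear k u v c).
pose f : {linear 'M[R]_(m, n) -> 'cV[R]_d} := HB.pack (mean^~ c) f_mixin.
have -> : mean h c = f h by [].
rewrite {1}[h]matrix_sum_delta linear_sum summxE; apply: eq_bigr => i _.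
rewrite linear_sum summxE; apply: eq_bigr => j _.
by rewrite linearZ mxE.
Qed.

(** Minus half the derivative of the squared distance at [theta] in the direction [h]. *)
Let inner (theta h : 'M[R]_(m, n)) w c : R :=
  \sum_l (Y w - mean theta c) l ord0 * mean h c l ord0.

Let quadratic_growth_inner (theta h : 'M[R]_(m, n)) :
  quadratic_growth (inner theta h).
Proof.
apply: quadratic_growth_sum => l; split.
  apply: measurable_funM; first exact: measurable_coordB.
  exact: (measurableT_comp (measurable_mean h l) measurable_snd).
exists ((1 + M * `|theta|) * (M * `|h|)) => w c.
rewrite normrM -N_sqr mulrAC ler_pM// (le_trans (coordB_le _ _ _ _))//.
by rewrite mulrC ler_wpM2l ?addr_ge0 ?mulr_ge0// expr2 ler_peMr.
Qed.

Let quadratic_growth_sqnorm_mean (h : 'M[R]_(m, n)) :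
  quadratic_growth (fun _ c => sqnorm (mean h c)).
Proof.
apply: quadratic_growth_sum => l; split.
  apply: measurable_funX.
  exact: (measurableT_comp (measurable_mean h l) measurable_snd).
exists ((M * `|h|) ^+ 2) => w c.
rewrite normrX -N_sqr -[leLHS]mulr1 ler_pM ?exprn_ege1//.
by rewrite lerXn2r ?nnegrE ?mulr_ge0.
Qed.

Let quadratic_growth_sqdist (theta : 'M[R]_(m, n)) :
  quadratic_growth (fun w c => sqnorm (Y w - mean theta c)).
Proof.
apply: quadratic_growth_sum => l; split.
  by apply: measurable_funX; exact: measurable_coordB.
exists ((1 + M * `|theta|) ^+ 2) => w c.
rewrite normrX -N_sqr -exprMn lerXn2r ?nnegrE ?mulr_ge0 ?addr_ge0 ?mulr_ge0//.
by rewrite mulrC coordB_le.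
Qed.

Let sqdistD (theta h : 'M[R]_(m, n)) w c : sqnorm (Y w - mean (theta + h) c) =
  sqnorm (Y w - mean theta c) - 2 * inner theta h w c + sqnorm (mean h c).
Proof.
rewrite /sqnorm /inner mulr_sumr -sumrB -big_split; apply: eq_bigr => l _ /=.
have -> : (Y w - mean (theta + h) c) l ord0 =
    (Y w - mean theta c) l ord0 - mean h c l ord0.
  by rewrite meanD opprD addrA [LHS]mxE [X in _ + X]mxE.
by ring.
Qed.

(** The candidate for the common gradient of [Q theta] and [L] at [theta]. *)
Let score (theta : 'M[R]_(m, n)) : 'M[R]_(m, n) :=
  \matrix_(i, j) (sigma ^- 2 * E theta (inner theta (delta_mx i j))).

(** The logarithm of the ratio of the component densities at [theta + h] and at [theta]. *)
Let gain (theta h : 'M[R]_(m, n)) w c : R :=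
  (sqnorm (Y w - mean theta c) - sqnorm (Y w - mean (theta + h) c)) /
  (2 * sigma ^+ 2).

Let gainE (theta h : 'M[R]_(m, n)) w c : gain theta h w c =
  sigma ^- 2 * inner theta h w c + - (2 * sigma ^+ 2)^-1 * sqnorm (mean h c).
Proof. by rewrite /gain sqdistD; field; rewrite gt_eqF. Qed.

Let quadratic_growth_gain (theta h : 'M[R]_(m, n)) :
  quadratic_growth (gain theta h).
Proof.
rewrite (_ : gain theta h = fun w c => sigma ^- 2 * inner theta h w c +
    - (2 * sigma ^+ 2)^-1 * sqnorm (mean h c)); last first.
  by apply/funext => w; apply/funext => c; exact: gainE.
by apply: quadratic_growthD; exact: quadratic_growthZ.
Qed.

Let innerE (theta h : 'M[R]_(m, n)) : inner theta h =
  fun w c => \sum_i \sum_j h i j * inner theta (delta_mx i j) w c.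
Proof.
apply/funext => w; apply/funext => c; rewrite /inner.
under eq_bigr => l _.
  rewrite mean_coord mulr_sumr.
  under eq_bigr => i _ do rewrite mulr_sumr.
  over.
rewrite exchange_big; apply: eq_bigr => i _ /=.
rewrite exchange_big; apply: eq_bigr => j _ /=.
by rewrite mulr_sumr; apply: eq_bigr => l _; rewrite mulrCA.
Qed.

Let expectation_inner (theta h : 'M[R]_(m, n)) :
  sigma ^- 2 * E theta (inner theta h) = \sum_i \sum_j score theta i j * h i j.
Proof.
rewrite innerE posterior_expectation_sum; last first.
  by move=> i; apply: quadratic_growth_sum => j; exact: quadratic_growthZ.
rewrite mulr_sumr; apply: eq_bigr => i _.
rewrite posterior_expectation_sum; last by move=> j; exact: quadratic_growthZ.
rewrite mulr_sumr; apply: eq_bigr => j _.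
by rewrite posterior_expectationZ// mxE mulrCA [RHS]mulrC.
Qed.

Let surrogateE theta theta' : Q theta theta' =
  - (2 * sigma ^+ 2)^-1 * E theta (fun w c => sqnorm (Y w - mean theta' c)).
Proof. by []. Qed.

Let surrogate_gain (theta h : 'M[R]_(m, n)) :
  Q theta (theta + h) - Q theta theta = E theta (gain theta h).
Proof.
have gD := quadratic_growth_sqdist.
have -> : gain theta h = fun w c =>
    (2 * sigma ^+ 2)^-1 * sqnorm (Y w - mean theta c) +
    - (2 * sigma ^+ 2)^-1 * sqnorm (Y w - mean (theta + h) c).
  by apply/funext => w; apply/funext => c; rewrite /gain mulrC mulrDr mulNr mulrN.
rewrite posterior_expectationD; [|exact: quadratic_growthZ..].
rewrite !posterior_expectationZ; [|exact: gD..].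
rewrite (surrogateE theta (theta + h)) (surrogateE theta theta).
by move: (E theta _) (E theta _) => u v; ring.
Qed.

(* The quadratic part of [Q theta] is diagonal in the coordinates of the
   parameter, with coefficients [b theta]. *)
Hypothesis expected_sqnorm_mean : forall theta h,
  E theta (fun _ c => sqnorm (mean h c)) = \sum_i \sum_j b theta i j * h i j ^+ 2.

Let surrogate_increment (theta h : 'M[R]_(m, n)) :
  Q theta (theta + h) - Q theta theta =
  \sum_i \sum_j (score theta i j * h i j -
                 b theta i j / (2 * sigma ^+ 2) * h i j ^+ 2).
Proof.
rewrite surrogate_gain.
rewrite (_ : gain theta h = fun w c => sigma ^- 2 * inner theta h w c +
    - (2 * sigma ^+ 2)^-1 * sqnorm (mean h c)); last first.
  by apply/funext => w; apply/funext => c; exact: gainE.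
rewrite posterior_expectationD; [|exact: quadratic_growthZ..].
rewrite posterior_expectationZ// posterior_expectationZ//.
rewrite expectation_inner expected_sqnorm_mean mulr_sumr -big_split.
apply: eq_bigr => i _ /=; rewrite mulr_sumr -big_split; apply: eq_bigr => j _ /=.
by rewrite mulrA mulNr mulNr [X in _ - X * _]mulrC.
Qed.

Let remainder (theta : 'M[R]_(m, n)) : R :=
  \sum_i \sum_j `|b theta i j / (2 * sigma ^+ 2)|.

Let surrogate_remainder (theta h : 'M[R]_(m, n)) :
  `|Q theta (theta + h) - Q theta theta - \sum_i \sum_j score theta i j * h i j|
  <= remainder theta * `|h| ^+ 2.
Proof.
rewrite surrogate_increment -sumrB.
rewrite (le_trans (ler_norm_sum _ _ _))// mulr_suml ler_sum// => i _.
rewrite -sumrB (le_trans (ler_norm_sum _ _ _))// mulr_suml ler_sum// => j _.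
rewrite addrAC subrr add0r normrN normrM ler_wpM2l//.
rewrite normrX lerXn2r ?nnegrE//; exact: norm_coord_le.
Qed.

Let surrogate_gradient (theta : 'M[R]_(m, n)) :
  differentiable (Q theta) theta /\ gradient (Q theta) theta = score theta.
Proof.
apply: (gradient_eq_of_quadratic_remainder (C := remainder theta)) => h _.
exact: surrogate_remainder.
Qed.

(** Each of the [d] coordinates changes the squared distance by at most 2 (N y) (1 + M |theta|) (M
    |h|) + (M |h|)^2. Since |h| <= 1 <= N y, this is at most M (2 (1 + M |theta|) + M) |h| (N y). *)
Let growth (theta : 'M[R]_(m, n)) : R :=
  d%:R * M * (2 * (1 + M * `|theta|) + M) / (2 * sigma ^+ 2).

Let gain_le (theta h : 'M[R]_(m, n)) w c : `|h| <= 1 ->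
  `|gain theta h w c| <= growth theta * `|h| * N (Y w).
Proof.
move=> h1; rewrite /gain sqdistD normrM [X in _ * X]gtr0_norm; last first.
  by rewrite invr_gt0 mulr_gt0// exprn_gt0.
have -> : growth theta * `|h| * N (Y w) =
    d%:R * (M * (2 * (1 + M * `|theta|) + M) * `|h| * N (Y w)) /
    (2 * sigma ^+ 2).
  by rewrite /growth; move: (2 * sigma ^+ 2)^-1 (N _) => k y; ring.
have s2 : 0 <= (2 * sigma ^+ 2)^-1 by rewrite invr_ge0 mulr_ge0// sqr_ge0.
rewrite ler_wpM2r//.
have -> : sqnorm (Y w - mean theta c) - (sqnorm (Y w - mean theta c) -
    2 * inner theta h w c + sqnorm (mean h c)) =
    \sum_l (2 * ((Y w - mean theta c) l ord0 * mean h c l ord0) -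
            mean h c l ord0 ^+ 2).
  by rewrite sumrB -mulr_sumr -/(inner _ _ _ _) -/(sqnorm _); ring.
rewrite (le_trans (ler_norm_sum _ _ _))//.
have -> (a : R) : d%:R * a = \sum_(l < d) a.
  by rewrite sumr_const card_ord -[RHS]mulr_natl.
apply: ler_sum => l _.
rewrite (le_trans (ler_normB _ _))// normrX 2!normrM.
have u := coordB_le theta (Y w) c l; have v := mean_bounded h c l.
set t := 1 + M * `|theta| in u *.
have t0 : 0 <= t by rewrite addr_ge0 ?mulr_ge0.
have N1 := N_ge1 (Y w).
have uv : `|(Y w - mean theta c) l ord0| * `|mean h c l ord0| <=
    N (Y w) * t * (M * `|h|) by rewrite ler_pM.
have vv : `|mean h c l ord0| ^+ 2 <= M * `|h| * M * N (Y w).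
  apply: (@le_trans _ _ (M * `|h| * (M * `|h|))); first by rewrite expr2 ler_pM.
  rewrite -[leRHS]mulrA ler_wpM2l ?mulr_ge0// ler_wpM2l//.
  exact: le_trans N1.
rewrite ger0_norm//; nra.
Qed.

(* The EM inequality, together with its converse up to second order. *)
Let ln_mixture_increment (theta h : 'M[R]_(m, n)) w : `|h| <= 1 ->
  posterior_mean theta (gain theta h) w <=
  ln (mixture rho mean sigma (theta + h) (Y w)) -
    ln (mixture rho mean sigma theta (Y w)) <=
  posterior_mean theta (gain theta h) w +
    4 * (growth theta * `|h|) ^+ 2 * N (Y w) ^+ 2.
Proof.
move=> h1; have [mg _] := quadratic_growth_gain theta h.
have ms : measurable_fun setT (gain theta h w).
  exact: (measurableT_comp mg (measurable_pair1 w)).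
have [E0 EE] := ln_expectation_expR ms (integrable_weight theta (Y w))
  (fun c => ltW (weight_gt0 theta (Y w) c)) (Rintegral_weight theta (Y w))
  (fun c => gain_le theta w c h1).
have mix0 := mixture_gt0 theta (Y w).
(* Multiplying a component at [theta] by exp of the gain turns it into the component at [theta + h],
   so the posterior mean of exp of the gain is the ratio of the two mixtures. *)
suff eqE : \int[rho]_c ((expR \o gain theta h w) c * wt theta (Y w) c) =
    mixture rho mean sigma (theta + h) (Y w) / mixture rho mean sigma theta (Y w).
  move: EE; rewrite eqE ln_div ?posrE ?mixture_gt0//.
  by rewrite exprMn mulrA.
rewrite -RintegralZr//; last exact: integrable_component.
apply: eq_Rintegral => c _ /=.
rewrite /weight !componentE mulrA; congr (_ * _).
rewrite mulrCA -expRD; congr (_ * expR _).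
by rewrite /gain mulrBl addrAC subrr add0r.
Qed.

Let loglik_increment (theta h : 'M[R]_(m, n)) : `|h| <= 1 ->
  0 <= (L (theta + h) - L theta) - (Q theta (theta + h) - Q theta theta) <=
  4 * growth theta ^+ 2 * (\int[P]_w (N (Y w) ^+ 2)) * `|h| ^+ 2.
Proof.
move=> h1; have gg := quadratic_growth_gain theta h.
have il := integrable_ln_mixture.
have ig := integrable_posterior_mean theta gg.
pose k := 4 * (growth theta * `|h|) ^+ 2.
have ik : P.-integrable setT (fun w => (k * N (Y w) ^+ 2)%:E).
  exact: (integrableZl measurableT k integrable_N2).
have -> : L (theta + h) - L theta = \int[P]_w
    (ln (mixture rho mean sigma (theta + h) (Y w)) -
     ln (mixture rho mean sigma theta (Y w))).
  by rewrite (RintegralB measurableT (il _) (il _)).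
have ild : P.-integrable setT (fun w =>
    (ln (mixture rho mean sigma (theta + h) (Y w)) -
     ln (mixture rho mean sigma theta (Y w)))%:E).
  exact: (integrableB measurableT (il _) (il _)).
rewrite surrogate_gain subr_ge0 lerBlDr; apply/andP; split.
  apply: (le_Rintegral measurableT ig ild) => w _.
  by have /andP[] := ln_mixture_increment theta w h1.
have -> : 4 * growth theta ^+ 2 * (\int[P]_w (N (Y w) ^+ 2)) * `|h| ^+ 2 =
    \int[P]_w (k * N (Y w) ^+ 2).
  by rewrite (RintegralZl _ measurableT integrable_N2) /k; ring.
rewrite [leRHS]addrC /posterior_expectation -(RintegralD measurableT ig ik).
apply: (le_Rintegral measurableT ild (integrableD measurableT ig ik)) => w _.
by have /andP[] := ln_mixture_increment theta w h1.
Qed.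

Let loglik_gradient (theta : 'M[R]_(m, n)) :
  differentiable L theta /\ gradient L theta = score theta.
Proof.
apply: (gradient_eq_of_quadratic_remainder
  (C := 4 * growth theta ^+ 2 * (\int[P]_w (N (Y w) ^+ 2)) + remainder theta))
  => h h1.
have /andP[lo up] := loglik_increment theta h1.
(* The increment of [Q theta] is inserted between that of [L] and the linear form; both resulting
   differences are of order |h|^2. *)
rewrite -[X in `|X - _|](subrK (Q theta (theta + h) - Q theta theta)) -addrA.
rewrite (le_trans (ler_normD _ _))// mulrDl lerD//.
by rewrite ger0_norm.
Qed.

Lemma em_gradient (theta : 'M[R]_(m, n)) : [/\ differentiable (Q theta) theta,
  differentiable L theta & gradient (Q theta) theta = gradient L theta].
Proof.
have [dQ ->] := surrogate_gradient theta.
by have [dL ->] := loglik_gradient theta.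
Qed.

Hypothesis b_gt0 : forall theta i j, 0 < b theta i j.

(** The linear part of the increment of Q is the gradient of [L], and the quadratic coefficients are
    B / 2 with B = b / sigma^2. The square is thus completed by a step of size sigma^2 / b in each
    coordinate. *)
Lemma em_argmax theta theta' : is_argmax (Q theta) theta' <->
  forall i j, theta' i j =
    theta i j + sigma ^+ 2 / b theta i j * gradient L theta i j.
Proof.
have [_ ->] := loglik_gradient theta.
have s2 : 0 < sigma ^+ 2 by rewrite exprn_gt0.
pose B := \matrix_(i, j) (b theta i j / sigma ^+ 2).
have B_gt0 i j : 0 < B i j by rewrite mxE divr_gt0.
have Q_incr h : Q theta (theta + h) - Q theta theta = \sum_i \sum_j
    (score theta i j * h i j - B i j / 2 * h i j ^+ 2).
  rewrite surrogate_increment; apply: eq_bigr => i _; apply: eq_bigr => j _.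
  rewrite [B i j]mxE; congr (_ - _ * _); field.
  by rewrite gt_eqF.
rewrite (argmax_of_quadratic_increment theta' B_gt0 Q_incr).
have stepE i j : sigma ^+ 2 / b theta i j * score theta i j =
    score theta i j / B i j.
  rewrite [B i j]mxE; move: (score theta i j) (b_gt0 theta i j) => v b0.
  by field; rewrite !gt_eqF.
by split => th'E i j; rewrite th'E stepE.
Qed.

End em_core.

(** * Measurability and second moments of the observations *)

Section sample_moments.
Context {R : realType} {d : nat} {dO dX : measure_display}
  {Omega : measurableType dO} {X : measurableType dX} {Theta : Type}.
Variables (P : probability Omega R) (mean : Theta -> X -> 'cV[R]_d) (sigma : R).
Variables (Z : Omega -> 'cV[R]_d) (chi : Omega -> X) (theta : Theta).
Hypotheses (Z_gaussian : standard_gaussian P Z)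
  (measurable_chi : measurable_fun setT chi)
  (measurable_mean : forall i, measurable_fun setT (fun c => mean theta c i ord0)).

Let sample_coord w i : sample mean sigma Z chi theta w i ord0 =
  sigma * Z w i ord0 + mean theta (chi w) i ord0.
Proof. by rewrite !mxE. Qed.

Lemma measurable_sample i :
  measurable_fun setT (fun w => sample mean sigma Z chi theta w i ord0).
Proof.
under eq_fun do rewrite sample_coord.
apply: measurable_funD; first by apply: measurable_funM => //; exact: Z_gaussian.1.
exact: (measurableT_comp (measurable_mean i) measurable_chi).
Qed.

Lemma integrable_sqr_sample (C : R) i :
  (forall c, `|mean theta c i ord0| <= C) ->
  P.-integrable setT (fun w => (sample mean sigma Z chi theta w i ord0 ^+ 2)%:E).
Proof.
move=> meanC.
have iZ := integrableZl measurableT (2 * sigma ^+ 2)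
  (standard_gaussian_integrable_sqr i Z_gaussian).
have iC := finite_measure_integrable_cst P (2 * C ^+ 2) measurableT.
apply: (le_integrable _ _ _ (integrableD measurableT iZ iC)) => //.
  by apply/measurable_EFinP/measurable_funX; exact: measurable_sample.
move=> w _.
change (`|sample mean sigma Z chi theta w i ord0 ^+ 2|%:E <=
  `|2 * sigma ^+ 2 * Z w i ord0 ^+ 2 + 2 * C ^+ 2|%:E)%E.
rewrite lee_fin sample_coord.
have C2 : mean theta (chi w) i ord0 ^+ 2 <= C ^+ 2.
  by rewrite -real_normK ?num_real// lerXn2r ?nnegrE// (le_trans _ (meanC (chi w))).
rewrite ger0_norm ?sqr_ge0// ger0_norm; last first.
  by apply: addr_ge0; apply: mulr_ge0; rewrite ?sqr_ge0//; apply: mulr_ge0;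
    rewrite ?sqr_ge0.
(* Expanding this square gives (u + v)^2 <= 2 u^2 + 2 v^2, the source of both factors 2 in the
   dominating function. *)
have := sqr_ge0 (sigma * Z w i ord0 - mean theta (chi w) i ord0).
nra.
Qed.

End sample_moments.

(** * Positive integrals, finite latent spaces and orthogonal matrices *)

Lemma Rintegral_gt0 (R : realType) (d : measure_display) (T : measurableType d)
    (P : probability T R) (f : T -> R) :
  P.-integrable setT (EFin \o f) -> (forall x, 0 < f x) -> 0 < \int[P]_x f x.
Proof.
move=> fi f0; rewrite lt_neqAle Rintegral_ge0 ?andbT; last by move=> x _; exact: ltW.
apply/negP => /eqP if0.
have mf := measurable_int _ fi.
have /(ae_eq_integral_abs P measurableT mf) [N [mN PN0 sN]] :
    (\int[P]_x `|(EFin \o f) x| = 0)%E.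
  under eq_integral do rewrite gee0_abs ?lee_fin ?ltW//.
  by rewrite -[LHS]fineK ?(integrable_fin_num _ fi)// -[X in X%:E]if0.
(* The null set [N] contains every point where [f] is nonzero, hence every point, against
   [P setT = 1]. *)
have NT : N = setT.
  apply/seteqP; split => // x _; apply: sN => /= /(_ Logic.I) fx0.
  by have := f0 x; case: fx0 => ->; rewrite ltxx.
have : (P setT = 1)%E by exact: probability_setT.
by rewrite -NT PN0 => /esym/eqP; rewrite onee_eq0.
Qed.

(** [f] is a finite combination of indicators of points, and the indicator of [j] has integral
    [alpha j]. *)
Lemma Rintegral_ordinal (R : realType) (k : nat) (alpha : 'I_k.+1 -> R)
    (rho : probability 'I_k.+1 R) (f : 'I_k.+1 -> R) :
  (forall j, rho [set j] = (alpha j)%:E) ->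
  \int[rho]_c f c = \sum_j alpha j * f j.
Proof.
move=> rhoE.
have i1 j : rho.-integrable setT (fun c => (\1_[set j] c : R)%:E).
  apply: (le_integrable _ _ _
    (finite_measure_integrable_cst rho 1 measurableT)) => //.
  move=> c _; rewrite /= lee_fin normr1 indicE.
  by case: (_ \in _); rewrite ?normr0 ?normr1.
have -> : \int[rho]_c f c =
    fine (\int[rho]_c (\sum_j ((f j)%:E * (\1_[set j] c : R)%:E)))%E.
  congr fine; apply: eq_integral => c _.
  rewrite (bigD1 c)//= big1 ?adde0 => [|j jc].
    by rewrite indicE mem_set// mule1.
  rewrite indicE memNset ?mule0//= => cj; by move: jc; rewrite cj eqxx.
rewrite integral_sum//; last by move=> j; exact: integrableZl.
rewrite (eq_bigr (fun j => (alpha j * f j)%:E)) ?sumEFin// => j _.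
rewrite integralZl// integral_indic// setIT.
by rewrite EFinM muleC -rhoE.
Qed.

(** In the discrete sigma-algebra every preimage is measurable. *)
Lemma measurable_fun_ordinal (R : realType) (k : nat) (f : 'I_k.+1 -> R) :
  measurable_fun setT f.
Proof. by []. Qed.

(** The diagonal of [A *m A^T = 1%:M] says that the squares in each row of [A] sum to 1. *)
Lemma orthogonal_group_coord_le1 (R : realType) (d : nat) (G : set 'M[R]_d)
    A i j :
  orthogonal_group G -> G A -> `|A i j| <= 1.
Proof.
move=> [orth _ _ _] /orth /matrixP/(_ i i); rewrite !mxE eqxx => rowE.
rewrite -[leLHS]normr_id -(@ler_pXn2r _ 2) ?nnegrE// expr1n normr_id.
rewrite real_normK ?num_real// -[leRHS]rowE (bigD1 j)//= mxE -expr2 lerDl.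
by apply: sumr_ge0 => l _; rewrite mxE -expr2 sqr_ge0.
Qed.

Lemma sqnormE (R : realType) (d : nat) (x : 'cV[R]_d) :
  sqnorm x = (x^T *m x) ord0 ord0.
Proof. by rewrite mxE; apply: eq_bigr => i _; rewrite mxE expr2. Qed.

Lemma orthogonal_group_sqnorm (R : realType) (d : nat) (G : set 'M[R]_d) A
    (x : 'cV[R]_d) :
  orthogonal_group G -> G A -> sqnorm (A *m x) = sqnorm x.
Proof.
move=> [orth _ _ _] /orth /mulmx1C AtA.
by rewrite !sqnormE trmx_mul mulmxA -(mulmxA _ A^T) AtA mulmx1.
Qed.

(** * The finite mixture model *)

Section finite_mixture.
Context {R : realType} {d k : nat} {dO : measure_display}
  {Omega : measurableType dO}.
Variables (P : probability Omega R) (rho : probability 'I_k.+1 R).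
Variables (alpha : 'I_k.+1 -> R) (sigma : R).
Variables (Z : Omega -> 'cV[R]_d) (chi : Omega -> 'I_k.+1).
Variable theta_star : 'M[R]_(d, k.+1).
Hypotheses (sigma_gt0 : 0 < sigma) (alpha_gt0 : forall j, 0 < alpha j)
  (rhoE : forall j, rho [set j] = (alpha j)%:E).
Hypotheses (Z_gaussian : standard_gaussian P Z)
  (measurable_chi : measurable_fun setT chi).

Local Notation mean := (@mixture_mean R d k).
Local Notation Y := (sample mean sigma Z chi theta_star).
Local Notation growth := (quadratic_growth mean sigma Z chi theta_star).
Local Notation E := (posterior_expectation P rho mean sigma Z chi theta_star).

Lemma mixture_mean_linear a (u v : 'M[R]_(d, k.+1)) c :
  mean (a *: u + v) c = a *: mean u c + mean v c.
Proof. by apply/matrixP => i j; rewrite !mxE. Qed.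

Lemma mixture_mean_bounded (h : 'M[R]_(d, k.+1)) c i :
  `|mean h c i ord0| <= 1 * `|h|.
Proof. by rewrite mul1r mxE norm_coord_le. Qed.

Lemma measurable_mixture_mean (h : 'M[R]_(d, k.+1)) i :
  measurable_fun setT (fun c => mean h c i ord0).
Proof. exact: measurable_fun_ordinal. Qed.

Lemma measurable_mixture_sample i : measurable_fun setT (fun w => Y w i ord0).
Proof.
exact: measurable_sample Z_gaussian measurable_chi
  (fun i => measurable_mixture_mean theta_star i) i.
Qed.

Lemma integrable_sqr_mixture_sample i :
  P.-integrable setT (fun w => (Y w i ord0 ^+ 2)%:E).
Proof.
exact: (integrable_sqr_sample (mean := mean) (theta := theta_star) _
  Z_gaussian measurable_chi
  (fun i => measurable_mixture_mean theta_star i)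
  (fun c => mixture_mean_bounded theta_star c i)).
Qed.

(** The indicator of label [j], taken as an integrand of quadratic growth: its posterior mean is
    [alpha j] times the weight of [j], which brings the weights under the general integrability
    result. *)
Let isj (j : 'I_k.+1) (w : Omega) (c : 'I_k.+1) : R := (c == j)%:R.

Let growth_isj j : growth (isj j).
Proof.
split.
  exact: (measurableT_comp
    (measurable_fun_ordinal (fun c : 'I_k.+1 => (c == j)%:R : R)) measurable_snd).
exists 1 => w c; rewrite mul1r ger0_norm// (@le_trans _ _ 1) ?lern1 ?leq_b1//.
by rewrite lerDl; apply: sumr_ge0 => i _; exact: sqr_ge0.
Qed.

Let posterior_isj theta j w : posterior_mean rho mean sigma Z chi theta_star
  theta (isj j) w = alpha j * weight rho mean sigma theta (Y w) j.
Proof.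
rewrite /posterior_mean (Rintegral_ordinal _ rhoE) (bigD1 j)//= big1 ?addr0.
  by rewrite /isj eqxx mul1r.
by move=> c cj; rewrite /isj (negbTE cj) mul0r mulr0.
Qed.

Let integrable_weight_sample theta j :
  P.-integrable setT (fun w => (weight rho mean sigma theta (Y w) j)%:E).
Proof.
have ij := integrable_posterior_mean rho sigma_gt0 ler01 mixture_mean_bounded
  measurable_mixture_mean measurable_mixture_sample
  integrable_sqr_mixture_sample theta (growth_isj j).
apply: eq_integrable (integrableZl measurableT (alpha j)^-1 ij) => // w _.
rewrite /= -EFinM posterior_isj mulKf// gt_eqF//; exact: alpha_gt0.
Qed.

Local Notation ew := (expected_weight P rho mean sigma Z chi).

(** This makes the quadratic coefficients of Q positive and the division in the step size
    genuine. *)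
Lemma expected_weight_gt0 theta j : 0 < ew theta theta_star j.
Proof.
apply: Rintegral_gt0; first exact: integrable_weight_sample.
move=> w; exact: (weight_gt0 rho sigma_gt0 ler01 mixture_mean_bounded
  measurable_mixture_mean).
Qed.

(** The squared norm of column [c] is the sum over all entries of [h i j ^+ 2] times the indicator
    of [c = j], so averaging leaves one diagonal coefficient per column. *)
Lemma mixture_expected_sqnorm_mean (theta h : 'M[R]_(d, k.+1)) :
  E theta (fun _ c => sqnorm (mean h c)) =
  \sum_i \sum_j (\matrix_(i, j) (alpha j * ew theta theta_star j)
                  : 'M[R]_(d, k.+1)) i j * h i j ^+ 2.
Proof.
have -> : (fun (_ : Omega) c => sqnorm (mean h c)) =
    fun w c => \sum_i \sum_j h i j ^+ 2 * isj j w c.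
  apply/funext => w; apply/funext => c; apply: eq_bigr => i _.
  rewrite mxE (bigD1 c)//= big1 ?addr0 /isj ?eqxx ?mulr1// => j jc.
  by rewrite eq_sym (negbTE jc) mulr0.
have sumE := posterior_expectation_sum rho sigma_gt0 ler01 mixture_mean_bounded
  measurable_mixture_mean measurable_mixture_sample
  integrable_sqr_mixture_sample theta.
have scaleE := posterior_expectationZ rho sigma_gt0 ler01 mixture_mean_bounded
  measurable_mixture_mean measurable_mixture_sample
  integrable_sqr_mixture_sample theta.
rewrite sumE; last first.
  by move=> i; apply: quadratic_growth_sum => j; exact: quadratic_growthZ.
apply: eq_bigr => i _.
rewrite sumE; last by move=> j; exact: quadratic_growthZ.
apply: eq_bigr => j _.
rewrite scaleE// [in RHS]mxE mulrC; congr (_ * _).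
rewrite /posterior_expectation (eq_Rintegral _
  (fun w _ => posterior_isj theta j w)).
exact: (RintegralZl _ measurableT (integrable_weight_sample theta j)).
Qed.

End finite_mixture.

(** * The orbit retrieval model *)

Section orbit_retrieval.
Context {R : realType} {d : nat} {dO dX : measure_display}
  {Omega : measurableType dO} {X : measurableType dX}.
Variables (P : probability Omega R) (rho : probability X R).
Variables (g : X -> 'M[R]_d) (sigma : R).
Variables (Z : Omega -> 'cV[R]_d) (chi : Omega -> X).
Variable theta_star : 'cV[R]_d.
Hypotheses (sigma_gt0 : 0 < sigma) (g_orthogonal : orthogonal_group (range g))
  (measurable_g : forall i j, measurable_fun setT (fun c => g c i j)).
Hypotheses (Z_gaussian : standard_gaussian P Z)
  (measurable_chi : measurable_fun setT chi).

Local Notation mean := (orbit_mean g).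
Local Notation Y := (sample mean sigma Z chi theta_star).
Local Notation E := (posterior_expectation P rho mean sigma Z chi theta_star).

Lemma orbit_mean_linear a (u v : 'cV[R]_d) c :
  mean (a *: u + v) c = a *: mean u c + mean v c.
Proof. by rewrite /orbit_mean mulmxDr scalemxAr. Qed.

(** Entries of orthogonal matrices are at most 1 in absolute value, so each of the [d] terms of a
    matrix-vector coordinate is bounded by the sup norm of [h]. *)
Lemma orbit_mean_bounded (h : 'cV[R]_d) c i :
  `|mean h c i ord0| <= d%:R * `|h|.
Proof.
rewrite mxE (le_trans (ler_norm_sum _ _ _))//.
have -> : d%:R * `|h| = \sum_(j < d) `|h|.
  by rewrite sumr_const card_ord -[RHS]mulr_natl.
apply: ler_sum => j _; rewrite normrM -[leRHS]mul1r ler_pM ?norm_coord_le//.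
by apply: (orthogonal_group_coord_le1 _ _ g_orthogonal); exists c.
Qed.

Lemma measurable_orbit_mean (h : 'cV[R]_d) i :
  measurable_fun setT (fun c => mean h c i ord0).
Proof.
under eq_fun do rewrite mxE.
by apply: measurable_sum => j; exact: measurable_funM.
Qed.

Lemma measurable_orbit_sample i : measurable_fun setT (fun w => Y w i ord0).
Proof.
exact: measurable_sample Z_gaussian measurable_chi
  (fun i => measurable_orbit_mean theta_star i) i.
Qed.

Lemma integrable_sqr_orbit_sample i :
  P.-integrable setT (fun w => (Y w i ord0 ^+ 2)%:E).
Proof.
exact: (integrable_sqr_sample (mean := mean) (theta := theta_star) _
  Z_gaussian measurable_chi
  (fun i => measurable_orbit_mean theta_star i)
  (fun c => orbit_mean_bounded theta_star c i)).
Qed.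

(** Orthogonal matrices preserve the squared norm, so the integrand is constant in [c], and both the
    weights and [P] have total mass 1. All coefficients being 1, the EM step size is sigma^2 in
    every coordinate. *)
Lemma orbit_expected_sqnorm_mean (theta h : 'cV[R]_d) :
  E theta (fun _ c => sqnorm (mean h c)) =
  \sum_i \sum_j (const_mx 1 : 'cV[R]_d) i j * h i j ^+ 2.
Proof.
have -> : (fun (_ : Omega) c => sqnorm (mean h c)) = fun _ _ => sqnorm h.
  apply/funext => w; apply/funext => c.
  by apply: (orthogonal_group_sqnorm _ g_orthogonal); exists c.
have W1 := Rintegral_weight rho sigma_gt0 (ler0n _ d) orbit_mean_bounded
  measurable_orbit_mean theta.
have iW := integrable_weight rho sigma_gt0 measurable_orbit_mean theta.
transitivity (\int[P]_w sqnorm h).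
  apply: eq_Rintegral => w _.
  by rewrite /posterior_mean (RintegralZl _ measurableT (iW _)) W1 mulr1.
rewrite Rintegral_cst//.
have -> : fine (P [set: Omega]) = 1 by rewrite probability_setT.
rewrite mulr1; apply: eq_bigr => i _.
by rewrite big_ord1 mxE mul1r.
Qed.

End orbit_retrieval.

(** * Both models as instances of the general EM identities *)

Theorem proposition3p1 (R : realType) (d : nat) (sigma : R)
    (sigma_gt0 : 0 < sigma) :
  (* finite mixture model with K = k.+1 components *)
  (forall (k : nat) (alpha : 'I_k.+1 -> R) (rho : probability 'I_k.+1 R)
     (dO : measure_display) (Omega : measurableType dO)
     (P : probability Omega R)
     (Z : Omega -> 'cV[R]_d) (chi : Omega -> 'I_k.+1)
     (theta_star : 'M[R]_(d, k.+1)),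
     (forall j, 0 < alpha j) ->
     \sum_j alpha j = 1 ->
     (forall j, rho [set j] = (alpha j)%:E) ->
     standard_gaussian P Z ->
     has_law P chi rho ->
     independent P Z chi ->
     let mean := @mixture_mean R d k in
     let L := loglik P rho mean sigma Z chi theta_star in
     let Q := surrogate P rho mean sigma Z chi theta_star in
     [/\ forall theta : 'M[R]_(d, k.+1),
           [/\ differentiable (Q theta) theta,
               differentiable L theta &
               gradient (Q theta) theta = gradient L theta],
         forall (tau : R) (theta_ : nat -> 'M[R]_(d, k.+1)),
           gradient_EM Q tau theta_ <-> gradient_ascent L tau theta_ &
         forall (theta_ : nat -> 'M[R]_(d, k.+1)) (t : nat),
           is_argmax (Q (theta_ t)) (theta_ t.+1) <->
           forall c : 'I_k.+1,
             let tau := sigma ^+ 2 /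
               (alpha c *
                expected_weight P rho mean sigma Z chi (theta_ t) theta_star c)
             in
             col c (theta_ t.+1) =
             col c (theta_ t) + tau *: col c (gradient L (theta_ t))])
  /\
  (* orbit retrieval model *)
  (forall (dX : measure_display) (X : measurableType dX)
     (g : X -> 'M[R]_d) (rho : probability X R)
     (dO : measure_display) (Omega : measurableType dO)
     (P : probability Omega R)
     (Z : Omega -> 'cV[R]_d) (chi : Omega -> X)
     (theta_star : 'cV[R]_d),
     orthogonal_group (range g) ->
     (forall i j, measurable_fun setT (fun c => g c i j)) ->
     standard_gaussian P Z ->
     has_law P chi rho ->
     independent P Z chi ->
     let mean := orbit_mean g in
     let L := loglik P rho mean sigma Z chi theta_star in
     let Q := surrogate P rho mean sigma Z chi theta_star in
     [/\ forall theta : 'cV[R]_d,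
           [/\ differentiable (Q theta) theta,
               differentiable L theta &
               gradient (Q theta) theta = gradient L theta],
         forall (tau : R) (theta_ : nat -> 'cV[R]_d),
           gradient_EM Q tau theta_ <-> gradient_ascent L tau theta_ &
         forall (theta_ : nat -> 'cV[R]_d) (t : nat),
           is_argmax (Q (theta_ t)) (theta_ t.+1) <->
           theta_ t.+1 =
             theta_ t + sigma ^+ 2 *: gradient L (theta_ t)]).
Proof.
split.
  move=> k alpha rho dO Omega P Z chi theta_star alpha_gt0 _ rhoE Z_gaussian.
  move=> [measurable_chi _] _ mean L Q.
  have sqE := mixture_expected_sqnorm_mean theta_star sigma_gt0 alpha_gt0
    rhoE Z_gaussian measurable_chi.
  have mY := measurable_mixture_sample sigma theta_star Z_gaussian measurable_chi.
  have iY := integrable_sqr_mixture_sample sigma theta_star Z_gaussian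
    measurable_chi.
  (* The bound on the means holds with M = 1, as their coordinates are entries of the parameter. *)
  have grad := em_gradient sigma_gt0 ler01 (@mixture_mean_linear R d k)
    (@mixture_mean_bounded R d k) (@measurable_mixture_mean R d k) mY iY
    sqE.
  split => [theta|tau theta_|theta_ t].
  - exact: grad.
  - split => step t; have [_ _ eq_grad] := grad (theta_ t).
      by rewrite step eq_grad.
    by rewrite step -eq_grad.
  - have b_gt0 theta i j : 0 < (\matrix_(i, j) (alpha j * expected_weight P rho
        mean sigma Z chi theta theta_star j) : 'M[R]_(d, k.+1)) i j.
      rewrite mxE mulr_gt0//.
      exact: (expected_weight_gt0 theta_star sigma_gt0 alpha_gt0 rhoE
        Z_gaussian measurable_chi).
    rewrite (em_argmax sigma_gt0 ler01 (@mixture_mean_linear R d k)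
      (@mixture_mean_bounded R d k) (@measurable_mixture_mean R d k) mY iY
      sqE b_gt0).
    split => [step c|step i j].
      by apply/matrixP => i j; rewrite mxE step !mxE.
    by have /matrixP/(_ i ord0) := step j; rewrite !mxE.
move=> dX X g rho dO Omega P Z chi theta_star g_orthogonal measurable_g.
move=> Z_gaussian [measurable_chi _] _ mean L Q.
have meanM := measurable_orbit_mean measurable_g.
have meanB := orbit_mean_bounded g_orthogonal.
have sqE := orbit_expected_sqnorm_mean P rho Z chi theta_star sigma_gt0
  g_orthogonal measurable_g.
have mY := measurable_orbit_sample sigma theta_star measurable_g Z_gaussian
  measurable_chi.
have iY := integrable_sqr_orbit_sample sigma theta_star g_orthogonal
  measurable_g Z_gaussian measurable_chi.
have grad := em_gradient sigma_gt0 (ler0n _ d) (orbit_mean_linear g) meanB meanM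
  mY iY sqE.
split => [theta|tau theta_|theta_ t].
- exact: grad.
- split => step t; have [_ _ eq_grad] := grad (theta_ t).
    by rewrite step eq_grad.
  by rewrite step -eq_grad.
- have b_gt0 (theta : 'cV[R]_d) i j : 0 < (const_mx 1 : 'cV[R]_d) i j.
    by rewrite mxE.
  rewrite (em_argmax sigma_gt0 (ler0n _ d) (orbit_mean_linear g) meanB meanM
    mY iY sqE b_gt0).
  split => [step|step i j].
    by apply/matrixP => i j; rewrite step !mxE divr1.
  by rewrite step !mxE divr1.
Qed.
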